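(* There is an algorithm which, given an instance $G=(A\cup B,E)$ of the strongly stable matching problem that admits at least one strongly stable matching, computes a maximal sequence of strongly stable matchings of $G$.
   Context: An instance of the strongly stable matching problem is a finite bipartite graph $G=(A\cup B,E)$ (vertices of $A$ are ''men'', of $B$ ''women'') in which every vertex $v$ has a preference list: its neighbours are partitioned into disjoint ties (possibly singletons) which are linearly ordered. For neighbours $x,y$ of $v$ write $x\succ_v y$ if $x$ lies in a strictly earlier tie than $y$, $x=_v y$ if in the same tie, $x\succeq_v y$ if either. A matching is a set of pairwise vertex-disjoint edges; $M(v)$ is the partner of $v$. An edge $e\in E\setminus M$ blocks $M$ if its endpoints can be labelled $x,y$ with ($x$ unmatched or $y\succ_x M(x)$) and ($y$ unmatched or $x\succeq_y M(y)$); $M$ is strongly stable if no edge blocks it. All strongly stable matchings match the same vertices. For strongly stable $M,N$: $M\succeq N$ if $M(m)\succeq_m N(m)$ for every matched man $m$, and $M\succ N$ if moreover some man $m$ has $M(m)\succ_m N(m)$. A man-optimal strongly stable matching is one in which every man gets a partner at least as good (w.r.t. his preferences) as in any strongly stable matching; woman-optimal is defined symmetrically for women. A maximal sequence of strongly stable matchings is a sequence $M_0\succ M_1\succ\dots\succ M_z$ of strongly stable matchings such that $M_0$ is man-optimal, $M_z$ is woman-optimal, and for each $1\le i\le z$ there is no strongly stable matching $M'$ with $M_{i-1}\succ M'\succ M_i$. *)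

(* Defs.v *)
From mathcomp Require Import all_boot.

Set Implicit Arguments.
Unset Strict Implicit.
Unset Printing Implicit Defensive.

(** * Strongly stable matchings *)

(* An edge is the set of its two endpoints.  [pref v] lists the ties of [v],
   most preferred first: it is an ordered partition of the neighbourhood of
   [v] into nonempty ties, and is empty when [v] is isolated. *)
Record instance (V : finType) := Instance {
  men : {set V};
  edges : {set {set V}};
  pref : V -> seq {set V};
  edges_bipartite : forall e, e \in edges ->
    exists x y, [/\ x \in men, y \notin men & e = [set x; y]];
  pref_uniq : forall v, uniq (pref v);
  pref_partition : forall v,
    partition [set T in pref v] [set u | [set v; u] \in edges]
}.

Section StrongStability.

Variables (V : finType) (G : instance V).

Definition women : {set V} := ~: men G.

(* Meaningful only when [x] is a neighbour of [v]. *)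
Definition tie_index (v x : V) : nat :=
  find (fun T : {set V} => x \in T) (pref G v).

Definition prefers (v x y : V) : bool := tie_index v x < tie_index v y.
Definition weakly_prefers (v x y : V) : bool := tie_index v x <= tie_index v y.

Definition matching (M : {set {set V}}) : bool :=
  (M \subset edges G) && trivIset M.

(* When [M] is a matching there is at most one such [u]. *)
Definition partner (M : {set {set V}}) (v : V) : option V :=
  [pick u | [set v; u] \in M].

Definition blocks (M : {set {set V}}) (e : {set V}) : bool :=
  [&& e \in edges G, e \notin M &
    [exists x, exists y,
      [&& e == [set x; y],
          (if partner M x is Some z then prefers x y z else true) &
          (if partner M y is Some z then weakly_prefers y x z else true)]]].

Definition strongly_stable (M : {set {set V}}) : bool :=
  matching M && ~~ [exists e, blocks M e].

(* Strongly stable matchings all match the same vertices, so the cases where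
   exactly one of [M], [N] matches [v] are irrelevant to them; being matched is
   taken to be better than being unmatched. *)
Definition at_least_as_good (v : V) (M N : {set {set V}}) : bool :=
  match partner M v, partner N v with
  | Some x, Some y => weakly_prefers v x y
  | None, Some _ => false
  | _, None => true
  end.

Definition strictly_better (v : V) (M N : {set {set V}}) : bool :=
  match partner M v, partner N v with
  | Some x, Some y => prefers v x y
  | _, _ => false
  end.

Definition dominates (M N : {set {set V}}) : bool :=
  [forall m in men G, at_least_as_good m M N].

Definition strictly_dominates (M N : {set {set V}}) : bool :=
  dominates M N && [exists m in men G, strictly_better m M N].

Definition optimal_for (S : {set V}) (M : {set {set V}}) : bool :=
  strongly_stable M &&
  [forall (N | strongly_stable N), forall v in S, at_least_as_good v M N].

Definition man_optimal := optimal_for (men G).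
Definition woman_optimal := optimal_for women.

Definition immediately_dominates (M N : {set {set V}}) : bool :=
  strictly_dominates M N &&
  ~~ [exists M', [&& strongly_stable M', strictly_dominates M M' &
                     strictly_dominates M' N]].

Definition maximal_sequence (s : seq {set {set V}}) : bool :=
  if s is M0 :: s' then
    [&& all strongly_stable s, man_optimal M0, woman_optimal (last M0 s') &
        path immediately_dominates M0 s']
  else false.

End StrongStability.

(** * Algorithms *)

(* Programs compute partial functions on binary trees: this is a variable-free
   presentation of N. D. Jones's Turing-complete language WHILE, with
   [PCons p q] playing the part of a multi-variable store. *)

Inductive tree : Type := Leaf | Node of tree & tree.

Definition hd (t : tree) : tree := if t is Node x _ then x else Leaf.
Definition tl (t : tree) : tree := if t is Node _ y then y else Leaf.

Inductive prog : Type :=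
  | PId
  | PLeaf
  | PHd
  | PTl
  | PCons of prog & prog
  | PComp of prog & prog
  | PIf of prog & prog & prog
  | PWhile of prog & prog.

(* [eval p x y]: run on input [x], the program [p] halts with output [y].
   [PComp p q] runs [q] first; a test succeeds when its value is not [Leaf];
   [PWhile c p] iterates [p] on the current value as long as [c] succeeds. *)
Inductive eval : prog -> tree -> tree -> Prop :=
  | eval_id x : eval PId x x
  | eval_leaf x : eval PLeaf x Leaf
  | eval_hd x : eval PHd x (hd x)
  | eval_tl x : eval PTl x (tl x)
  | eval_cons p q x y z :
      eval p x y -> eval q x z -> eval (PCons p q) x (Node y z)
  | eval_comp p q x y z :
      eval q x y -> eval p y z -> eval (PComp p q) x z
  | eval_if_true c p q x a b y :
      eval c x (Node a b) -> eval p x y -> eval (PIf c p q) x y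
  | eval_if_false c p q x y :
      eval c x Leaf -> eval q x y -> eval (PIf c p q) x y
  | eval_while_stop c p x :
      eval c x Leaf -> eval (PWhile c p) x x
  | eval_while_step c p x a b y z :
      eval c x (Node a b) -> eval p x y -> eval (PWhile c p) y z ->
      eval (PWhile c p) x z.

Lemma eval_deterministic p x y z : eval p x y -> eval p x z -> y = z.
Proof.
move=> Hy; elim: Hy z => {p x y}.
- by move=> x z H; inversion H.
- by move=> x z H; inversion H.
- by move=> x z H; inversion H.
- by move=> x z H; inversion H.
- move=> p q x y z _ IHp _ IHq w H; inversion H; subst.
  by rewrite (IHp _ H2) (IHq _ H5).
- move=> p q x y z _ IHq _ IHp w H; inversion H; subst.
  by move: H5; rewrite -(IHq _ H2); apply: IHp.
- move=> c p q x a b y _ IHc _ IHp w H; inversion H; subst; first exact: IHp.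
  by have := IHc _ H5.
- move=> c p q x y _ IHc _ IHq w H; inversion H; subst; last exact: IHq.
  by have := IHc _ H5.
- move=> c p x _ IHc w H; inversion H; subst => //.
  by have := IHc _ H2.
- move=> c p x a b y z _ IHc _ IHp _ IHw w H; inversion H; subst.
    by have := IHc _ H4.
  by move: H6; rewrite -(IHp _ H3); apply: IHw.
Qed.

(** * Inputs and outputs as trees *)

Definition code_bool (b : bool) : tree := if b then Node Leaf Leaf else Leaf.

Definition code_nat (n : nat) : tree := iter n (Node Leaf) Leaf.

Definition code_option (T : Type) (f : T -> tree) (o : option T) : tree :=
  if o is Some x then Node (f x) Leaf else Leaf.

Definition code_seq (T : Type) (f : T -> tree) (s : seq T) : tree :=
  foldr (fun x t => Node (f x) t) Leaf s.

Definition code_vertex (V : finType) (v : V) : tree := code_nat (enum_rank v).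

Definition code_set (V : finType) (S : {set V}) : tree :=
  code_seq (@code_vertex V) (enum S).

(* For each vertex, its side and its preference list; the edges can be read off
   the preference lists. *)
Definition code_instance (V : finType) (G : instance V) : tree :=
  code_seq
    (fun v => Node (code_bool (v \in men G)) (code_seq (@code_set V) (pref G v)))
    (enum V).

(* For each vertex, its partner if any. *)
Definition code_matching (V : finType) (M : {set {set V}}) : tree :=
  code_seq (fun v => code_option (@code_vertex V) (partner M v)) (enum V).

(* Main.v *)
Require Import Defs.
From mathcomp Require Import all_boot.

(* Brute force: list all candidate partner assignments, keep the strongly stable
   ones, and grow a chain by inserting each of them in turn if it is strictly
   comparable to every member of the current chain.  The result is maximal under
   inclusion.  That its ends are man-optimal and woman-optimal rests on two
   facts.  First, for strongly stable M and N, giving every vertex of one side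
   the better of its two partners yields a strongly stable matching: a vertex x
   strictly better off in M has an M-partner strictly better off in N, since
   they would block N otherwise, and conversely; so M and N both match the
   vertices better off in M bijectively with those better off in N.  Hence each
   side has an optimal matching.  Second, what is better for all men is worse
   for all women.

   The program is obtained by closing the functions computed by programs, for
   fixed encodings of lists, pairs, options, numbers and Booleans, under the
   list combinators used by the algorithm. *)

Set Implicit Arguments.
Unset Strict Implicit.
Unset Printing Implicit Defensive.

(** * Computable functions on encoded data *)

(** The encoding is chosen by the type, so that closure properties can be stated for ordinary
    functions. *)
Class coded (T : Type) := code : T -> tree.

#[local] Instance coded_unit : coded unit := fun=> Leaf.
#[local] Instance coded_bool : coded bool := code_bool.
#[local] Instance coded_nat : coded nat := code_nat.
#[local] Instance coded_option T `{coded T} : coded (option T) :=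
  code_option code.
#[local] Instance coded_seq T `{coded T} : coded (seq T) := code_seq code.
#[local] Instance coded_prod S T `{coded S} `{coded T} : coded (S * T) :=
  fun t => Node (code t.1) (code t.2).

Definition computable X Y `{coded X} `{coded Y} (f : X -> Y) :=
  exists p, forall x, eval p (code x) (code (f x)).

Lemma eval_tl_eq x y : y = tl x -> eval PTl x y.
Proof. by move->; constructor. Qed.

(** * Closure under the basic program constructs and bounded loops *)

Section Closure.

Context X `{coded X}.

Lemma computable_ext Y `{coded Y} (f g : X -> Y) :
  f =1 g -> computable f -> computable g.
Proof. by move=> fg [p fp]; exists p => x; rewrite -fg. Qed.

Lemma computable_id : computable (fun x : X => x).
Proof. by exists PId => x; constructor. Qed.

Lemma computable_comp Y Z `{coded Y} `{coded Z} (f : X -> Y) (g : Y -> Z) :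
  computable g -> computable f -> computable (fun x => g (f x)).
Proof.
move=> [q gq] [p fp]; exists (PComp q p) => x.
exact: eval_comp (fp x) (gq _).
Qed.

Lemma computable_pair Y Z `{coded Y} `{coded Z} (f : X -> Y) (g : X -> Z) :
  computable f -> computable g -> computable (fun x => (f x, g x)).
Proof. by move=> [p fp] [q gq]; exists (PCons p q) => x; apply: eval_cons. Qed.

Lemma computable_fst Y Z `{coded Y} `{coded Z} (f : X -> Y * Z) :
  computable f -> computable (fun x => (f x).1).
Proof. by apply: computable_comp; exists PHd => x; exact: eval_hd. Qed.

Lemma computable_snd Y Z `{coded Y} `{coded Z} (f : X -> Y * Z) :
  computable f -> computable (fun x => (f x).2).
Proof. by apply: computable_comp; exists PTl => x; exact: eval_tl. Qed.

Lemma computable_false : computable (fun _ : X => false).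
Proof. by exists PLeaf => x; constructor. Qed.

Lemma computable_true : computable (fun _ : X => true).
Proof. by exists (PCons PLeaf PLeaf) => x; do 2!constructor. Qed.

Lemma computable_nil Y `{coded Y} : computable (fun _ : X => [::] : seq Y).
Proof. by exists PLeaf => x; constructor. Qed.

Lemma computable_none Y `{coded Y} : computable (fun _ : X => None : option Y).
Proof. by exists PLeaf => x; constructor. Qed.

Lemma computable_zero : computable (fun _ : X => 0).
Proof. by exists PLeaf => x; constructor. Qed.

Lemma computable_cons Y `{coded Y} (f : X -> Y) (g : X -> seq Y) :
  computable f -> computable g -> computable (fun x => f x :: g x).
Proof. by move=> [p fp] [q gq]; exists (PCons p q) => x; apply: eval_cons. Qed.

Lemma computable_some Y `{coded Y} (f : X -> Y) :
  computable f -> computable (fun x => Some (f x)).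
Proof. by move=> [p fp]; exists (PCons p PLeaf) => x; do 2?constructor. Qed.

Lemma computable_succ (f : X -> nat) :
  computable f -> computable (fun x => (f x).+1).
Proof. by move=> [p fp]; exists (PCons PLeaf p) => x; do 2?constructor. Qed.

(** The right subtree of the code of [n.+1] is the code of [n], and [tl Leaf = Leaf] accounts for
    [0.-1 = 0]. *)
Lemma computable_pred (f : X -> nat) :
  computable f -> computable (fun x => (f x).-1).
Proof.
apply: (computable_comp (g := predn)).
by exists PTl => -[|n]; apply: eval_tl_eq.
Qed.

Lemma computable_behead Y `{coded Y} (f : X -> seq Y) :
  computable f -> computable (fun x => behead (f x)).
Proof.
apply: (computable_comp (g := behead)).
by exists PTl => -[|y s]; apply: eval_tl_eq.
Qed.

Lemma computable_if Y `{coded Y} (c : X -> bool) (f g : X -> Y) :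
  computable c -> computable f -> computable g ->
  computable (fun x => if c x then f x else g x).
Proof.
move=> [r cr] [p fp] [q gq]; exists (PIf r p q) => x.
move: (cr x); case: (c x) => crx; last exact: eval_if_false.
exact: eval_if_true crx _.
Qed.

Lemma computable_match Y Z `{coded Y} `{coded Z}
    (o : X -> option Y) (f : X -> Y -> Z) (g : X -> Z) :
  computable o -> computable (fun t : X * Y => f t.1 t.2) -> computable g ->
  computable (fun x => if o x is Some y then f x y else g x).
Proof.
move=> [r orr] [p fp] [q gq].
(* [Some y] is coded as [Node (code y) Leaf]: the test [r] succeeds on it, and [PHd] extracts the
   code of [y], which is paired with the input for [p]. *)
exists (PIf r (PComp p (PCons PId (PComp PHd r))) q) => x.
move: (orr x); case: (o x) => [y|] orx; last exact: eval_if_false.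
apply: eval_if_true (orx) _; apply: eval_comp (fp (x, y)).
by apply: eval_cons; [exact: eval_id | apply: eval_comp orx _; exact: eval_hd].
Qed.

Lemma computable_nilp Y `{coded Y} (s : X -> seq Y) :
  computable s -> computable (fun x => nilp (s x)).
Proof.
move=> [p sp]; exists (PIf p PLeaf (PCons PLeaf PLeaf)) => x.
move: (sp x); case: (s x) => [|y s'] spx; last first.
  by apply: eval_if_true spx _; constructor.
by apply: eval_if_false spx _; do 2!constructor.
Qed.

Lemma computable_head Y `{coded Y} (y0 : X -> Y) (s : X -> seq Y) :
  computable y0 -> computable s -> computable (fun x => head (y0 x) (s x)).
Proof.
move=> [q yq] [p sp]; exists (PIf p (PComp PHd p) q) => x.
move: (sp x); case: (s x) => [|y s'] spx; first exact: eval_if_false.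
by apply: eval_if_true (spx) _; apply: eval_comp spx _; exact: eval_hd.
Qed.

(** A loop on a store [(x, (y, s))] of input, accumulator and remaining list, which stops when the
    code of [s] is [Leaf]. All recursion used later reduces to this loop. *)
Lemma computable_foldl Y Z `{coded Y} `{coded Z}
    (h : X -> Y -> Z -> Y) (y0 : X -> Y) (s : X -> seq Z) :
  computable (fun t : X * (Y * Z) => h t.1 t.2.1 t.2.2) ->
  computable y0 -> computable s ->
  computable (fun x => foldl (h x) (y0 x) (s x)).
Proof.
move=> [p hp] [q yq] [r sr].
(* One turn keeps [x], applies [h] to the accumulator and the head of the list, and drops that
   head. *)
pose step := PCons PHd (PCons
  (PComp p (PCons PHd (PCons (PComp PHd PTl) (PComp PHd (PComp PTl PTl)))))
  (PComp PTl (PComp PTl PTl))).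
exists (PComp (PComp PHd PTl)
  (PComp (PWhile (PComp PTl PTl) step) (PCons PId (PCons q r)))) => x.
pose final := (x, (foldl (h x) (y0 x) (s x), [::] : seq Z)).
apply: (eval_comp (y := code final)); last first.
  exact: eval_comp (eval_tl _) (eval_hd _).
apply: (eval_comp (y := code (x, (y0 x, s x)))).
  by apply: eval_cons; [exact: eval_id | apply: eval_cons].
rewrite /final; elim: (s x) (y0 x) => [|z s' IHs] y /=.
  by apply: eval_while_stop; exact: eval_comp (eval_tl _) (eval_tl _).
apply: eval_while_step (IHs _); first exact: eval_comp (eval_tl _) (eval_tl _).
apply: eval_cons; first exact: eval_hd.
apply: eval_cons; last first.
  exact: eval_comp (eval_comp (eval_tl _) (eval_tl _)) (eval_tl _).
apply: eval_comp (hp (x, (y, z))).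
apply: eval_cons; first exact: eval_hd.
apply: eval_cons; first exact: eval_comp (eval_tl _) (eval_hd _).
exact: eval_comp (eval_comp (eval_tl _) (eval_tl _)) (eval_hd _).
Qed.

(* [n] and [nseq n tt] have the same code. *)
Lemma computable_nseq (n : X -> nat) :
  computable n -> computable (fun x => nseq (n x) tt).
Proof.
move=> [p np]; exists p => x.
have nseqE k : code_seq (fun=> Leaf) (nseq k tt) = code_nat k.
  by elim: k => //= k ->.
by rewrite [code (nseq _ _)]nseqE; apply: np.
Qed.

End Closure.

Ltac basic_computability_step :=
  lazymatch goal with
  | |- computable (fun x => x) => exact: computable_id
  | |- computable (fun _ => false) => exact: computable_false
  | |- computable (fun _ => true) => exact: computable_true
  | |- computable (fun _ => [::]) => exact: computable_nil
  | |- computable (fun _ => None) => exact: computable_none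
  | |- computable (fun _ => 0) => exact: computable_zero
  | |- computable (fun x => (@?f x).1) => refine (computable_fst (f := f) _)
  | |- computable (fun x => (@?f x).2) => refine (computable_snd (f := f) _)
  | |- computable (fun _ => (_, _)) => apply: computable_pair
  | |- computable (fun _ => _ :: _) => apply: computable_cons
  | |- computable (fun _ => Some _) => apply: computable_some
  | |- computable (fun _ => _.+1) => apply: computable_succ
  | |- computable (fun _ => if _ then _ else _) => apply: computable_if
  | |- computable (fun _ => if _ is Some _ then _ else _) =>
      apply: computable_match
  | |- computable (fun _ => foldl _ _ _) => apply: computable_foldl
  | |- computable fst =>
      refine (computable_fst (f := fun x => x) (@computable_id _ _))
  | |- computable snd =>
      refine (computable_snd (f := fun x => x) (@computable_id _ _))
  | |- _ => assumption
  end.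

Ltac computability_step := basic_computability_step.

Ltac computability := repeat computability_step.

(** * Closure under list combinators, arithmetic comparisons and Boolean connectives *)

Section DerivedClosure.

Context X `{coded X}.

Lemma computable_rev Y `{coded Y} (s : X -> seq Y) :
  computable s -> computable (fun x => rev (s x)).
Proof.
move=> cs; have: computable (fun x => foldl (fun s y => y :: s) [::] (s x)).
  computability.
apply: computable_ext => x.
by rewrite -{1}[s x]revK foldl_rev; elim: (rev _) => //= y s' ->.
Qed.

Lemma computable_foldr Y Z `{coded Y} `{coded Z}
    (h : X -> Z -> Y -> Y) (y0 : X -> Y) (s : X -> seq Z) :
  computable (fun t : X * (Z * Y) => h t.1 t.2.1 t.2.2) ->
  computable y0 -> computable s ->
  computable (fun x => foldr (h x) (y0 x) (s x)).
Proof.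
move=> ch cy cs.
have: computable (fun x => foldl (fun y z => h x z y) (y0 x) (rev (s x))).
  apply: computable_foldl => //; last exact: computable_rev.
  pose swap (t : X * (Y * Z)) := (t.1, (t.2.2, t.2.1)).
  by apply: (computable_comp (f := swap) ch); rewrite /swap; computability.
by apply: computable_ext => x; rewrite foldl_rev.
Qed.

(** Makes [h] the step of a fold that ignores one component: the list element for [iter], the
    accumulated value for the combinators obtained from [foldr]. *)
Lemma computable_weaken Y Z W `{coded Y} `{coded Z} `{coded W}
    (h : X -> Y -> W) :
  computable (fun t : X * Y => h t.1 t.2) ->
  computable (fun t : X * (Y * Z) => h t.1 t.2.1).
Proof.
move=> ch; pose forget (t : X * (Y * Z)) := (t.1, t.2.1).
by apply: (computable_comp (f := forget) ch); rewrite /forget; computability.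
Qed.

Lemma computable_iter Y `{coded Y}
    (h : X -> Y -> Y) (y0 : X -> Y) (n : X -> nat) :
  computable (fun t : X * Y => h t.1 t.2) ->
  computable y0 -> computable n ->
  computable (fun x => iter (n x) (h x) (y0 x)).
Proof.
move=> ch cy cn.
have: computable (fun x => foldl (fun y _ => h x y) (y0 x) (nseq (n x) tt)).
  apply: computable_foldl => //; last exact: computable_nseq.
  exact: computable_weaken.
apply: computable_ext => x; elim: (n x) (y0 x) => // k IHk y.
by rewrite iterSr -IHk.
Qed.

Lemma computable_map Y Z `{coded Y} `{coded Z}
    (h : X -> Y -> Z) (s : X -> seq Y) :
  computable (fun t : X * Y => h t.1 t.2) -> computable s ->
  computable (fun x => map (h x) (s x)).
Proof.
move=> ch cs.
have: computable (fun x => foldr (fun y s => h x y :: s) [::] (s x)).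
  apply: computable_foldr => //; last exact: computable_nil.
  apply: computable_cons; last by computability.
  exact: computable_weaken.
by apply: computable_ext => x; elim: (s x) => //= y s' ->.
Qed.

Lemma computable_filter Y `{coded Y} (h : X -> Y -> bool) (s : X -> seq Y) :
  computable (fun t : X * Y => h t.1 t.2) -> computable s ->
  computable (fun x => filter (h x) (s x)).
Proof.
move=> ch cs.
have: computable (fun x =>
    foldr (fun y s => if h x y then y :: s else s) [::] (s x)).
  apply: computable_foldr => //; last exact: computable_nil.
  apply: computable_if; try computability.
  exact: computable_weaken.
by apply: computable_ext => x; elim: (s x) => //= y s' ->.
Qed.

Lemma computable_find Y `{coded Y} (h : X -> Y -> bool) (s : X -> seq Y) :
  computable (fun t : X * Y => h t.1 t.2) -> computable s ->
  computable (fun x => find (h x) (s x)).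
Proof.
move=> ch cs.
have: computable (fun x =>
    foldr (fun y n => if h x y then 0 else n.+1) 0 (s x)).
  apply: computable_foldr => //; last exact: computable_zero.
  apply: computable_if; try computability.
  exact: computable_weaken.
by apply: computable_ext => x; elim: (s x) => //= y s' ->.
Qed.

Lemma computable_all Y `{coded Y} (h : X -> Y -> bool) (s : X -> seq Y) :
  computable (fun t : X * Y => h t.1 t.2) -> computable s ->
  computable (fun x => all (h x) (s x)).
Proof.
move=> ch cs.
have: computable (fun x =>
    foldr (fun y b => if h x y then b else false) true (s x)).
  apply: computable_foldr => //; last exact: computable_true.
  apply: computable_if; try computability.
  exact: computable_weaken.
by apply: computable_ext => x; elim: (s x) => //= y s' ->.
Qed.

Lemma computable_has Y `{coded Y} (h : X -> Y -> bool) (s : X -> seq Y) :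
  computable (fun t : X * Y => h t.1 t.2) -> computable s ->
  computable (fun x => has (h x) (s x)).
Proof.
move=> ch cs.
have: computable (fun x =>
    foldr (fun y b => if h x y then true else b) false (s x)).
  apply: computable_foldr => //; last exact: computable_false.
  apply: computable_if; try computability.
  exact: computable_weaken.
by apply: computable_ext => x; elim: (s x) => //= y s' ->.
Qed.

Lemma computable_cat Y `{coded Y} (s t : X -> seq Y) :
  computable s -> computable t -> computable (fun x => s x ++ t x).
Proof.
move=> cs ct; have: computable (fun x => foldr cons (t x) (s x)).
  by apply: computable_foldr => //; computability.
by apply: computable_ext => x; elim: (s x) => //= y s' ->.
Qed.

Lemma computable_size Y `{coded Y} (s : X -> seq Y) :
  computable s -> computable (fun x => size (s x)).
Proof.
move=> cs; have: computable (fun x => foldl (fun n _ => n.+1) 0 (s x)).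
  by computability.
apply: computable_ext => x; rewrite -[RHS]add0n.
by elim: (s x) 0 => [|y s' IHs] n /=; rewrite ?addn0 // IHs addnS.
Qed.

Lemma computable_nth Y `{coded Y}
    (y0 : X -> Y) (s : X -> seq Y) (n : X -> nat) :
  computable y0 -> computable s -> computable n ->
  computable (fun x => nth (y0 x) (s x) (n x)).
Proof.
move=> cy cs cn.
have: computable (fun x => head (y0 x) (iter (n x) behead (s x))).
  apply: computable_head => //.
  apply: (computable_iter (h := fun=> behead)) => //.
  by apply: computable_behead; computability.
by apply: computable_ext => x; elim: (n x) (s x) => [|k IHk] [|y s'] //;
  rewrite iterSr IHk ?nth_nil.
Qed.

Lemma computable_andb (b c : X -> bool) :
  computable b -> computable c -> computable (fun x => b x && c x).
Proof.
by move=> cb cc; apply: computable_if cb cc _; computability.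
Qed.

Lemma computable_orb (b c : X -> bool) :
  computable b -> computable c -> computable (fun x => b x || c x).
Proof.
by move=> cb cc; apply: computable_if cb _ cc; computability.
Qed.

Lemma computable_implyb (b c : X -> bool) :
  computable b -> computable c -> computable (fun x => b x ==> c x).
Proof.
by move=> cb cc; apply: computable_if cb cc _; computability.
Qed.

Lemma computable_negb (b : X -> bool) :
  computable b -> computable (fun x => ~~ b x).
Proof. by move=> cb; apply: computable_if cb _ _; computability. Qed.

Lemma computable_leq (m n : X -> nat) :
  computable m -> computable n -> computable (fun x => m x <= n x).
Proof.
move=> cm cn.
(* Truncated subtraction: [m x <= n x] when [n x] predecessors bring [m x] to [0]. *)
have: computable (fun x => nilp (nseq (iter (n x) predn (m x)) tt)).
  apply: computable_nilp; apply: computable_nseq.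
  apply: (computable_iter (h := fun=> predn)) => //.
  by apply: computable_pred; computability.
apply: computable_ext => x; rewrite /nilp size_nseq; congr (_ == 0).
by elim: (n x) => [|k /= ->]; rewrite ?subn0 // subnS.
Qed.

Lemma computable_eqn (m n : X -> nat) :
  computable m -> computable n -> computable (fun x => m x == n x).
Proof.
move=> cm cn; have: computable (fun x => (m x <= n x) && (n x <= m x)).
  by apply: computable_andb; apply: computable_leq.
by apply: computable_ext => x; rewrite eqn_leq.
Qed.

End DerivedClosure.

Lemma computable_flatten X Y `{coded X} `{coded Y} (s : X -> seq (seq Y)) :
  computable s -> computable (fun x => flatten (s x)).
Proof.
move=> cs; apply: (computable_foldr (h := fun=> cat)) => //; last first.
  exact: computable_nil.
by apply: computable_cat; computability.
Qed.

Ltac computability_step ::=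
  cbv beta;
  lazymatch goal with
  | |- computable (fun _ => _ && _) => apply: computable_andb
  | |- computable (fun _ => _ || _) => apply: computable_orb
  | |- computable (fun _ => _ ==> _) => apply: computable_implyb
  | |- computable (fun _ => ~~ _) => apply: computable_negb
  | |- computable (fun _ => _ <= _) => apply: computable_leq
  | |- computable (fun _ => _ == _) => apply: computable_eqn
  | |- computable (fun _ => foldr _ _ _) => apply: computable_foldr
  | |- computable (fun _ => map _ _) => apply: computable_map
  | |- computable (fun _ => filter _ _) => apply: computable_filter
  | |- computable (fun _ => find _ _) => apply: computable_find
  | |- computable (fun _ => all _ _) => apply: computable_all
  | |- computable (fun _ => has _ _) => apply: computable_has
  | |- computable (fun _ => _ ++ _) => apply: computable_cat
  | |- computable (fun _ => flatten _) => apply: computable_flatten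
  | |- computable (fun _ => size _) => apply: computable_size
  | |- computable (fun _ => nth _ _ _) => apply: computable_nth
  | |- _ => basic_computability_step
  end.

(** * The algorithm *)

Definition strict (T : Type) (le : rel T) : rel T :=
  fun x y => le x y && ~~ le y x.

(** The relation will be only a preorder, since different matchings may give each man partners from
    the same tie. Requiring strict comparability keeps at most one of several equivalent
    elements. *)
Definition insert (T : Type) (le : rel T) (x : T) (s : seq T) : seq T :=
  if all (fun y => strict le x y || strict le y x) s
  then filter (fun y => strict le y x) s ++
       x :: filter (fun y => strict le x y) s
  else s.

Definition maximal_chain (T : Type) (le : rel T) (s : seq T) : seq T :=
  foldr (insert le) [::] s.

Section Algorithm.

(** Vertices are replaced by their positions in the enumeration: entry [i] holds the side and the
    ties of vertex [i]. Correspondingly, a matching is a list of optional partners. *)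
Variable I : seq (bool * seq (seq nat)).

(** This is [iota 0 (size I)], expressed by combinators already known to be computable. *)
Definition indices : seq nat := foldr (fun _ s => 0 :: map succn s) [::] I.

Definition ties_of (i : nat) : seq (seq nat) := (nth (false, [::]) I i).2.

Definition tie_idx (i j : nat) : nat :=
  find (fun T => has (fun k => k == j) T) (ties_of i).

Definition adjacent (i j : nat) : bool :=
  has (fun T => has (fun k => k == j) T) (ties_of i).

(** The value for an unmatched vertex exceeds the index of each of its ties, so the blocking
    condition becomes a pair of plain comparisons. *)
Definition rank_idx (c : seq (option nat)) (i : nat) : nat :=
  if nth None c i is Some j then tie_idx i j else size (ties_of i).

Definition matching_idx (c : seq (option nat)) : bool :=
  all (fun i =>
    if nth None c i is Some j then
      adjacent i j && (if nth None c j is Some k then k == i else false)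
    else true) indices.

Definition stable_idx (c : seq (option nat)) : bool :=
  matching_idx c &&
  all (fun i => all (fun j =>
    adjacent i j ==>
    ~~ ((tie_idx i j < rank_idx c i) && (tie_idx j i <= rank_idx c j)))
  indices) indices.

Definition candidates : seq (seq (option nat)) :=
  foldr (fun _ L =>
    [seq o :: c | o <- None :: [seq Some j | j <- indices], c <- L])
  [:: [::]] I.

Definition dominates_idx (c d : seq (option nat)) : bool :=
  all (fun i => (nth (false, [::]) I i).1 ==> (rank_idx c i <= rank_idx d i))
      indices.

Definition solve : seq (seq (option nat)) :=
  maximal_chain dominates_idx (filter stable_idx candidates).

End Algorithm.

Lemma computable_solve : computable solve.
Proof.
rewrite /solve /maximal_chain /insert /strict /candidates /stable_idx.
rewrite /matching_idx /dominates_idx /rank_idx /adjacent /tie_idx /ties_of.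
rewrite /indices.
by computability.
Qed.

(** * Joins and optimal matchings *)

Lemma set2_inj (T : finType) (a b c d : T) :
  [set a; b] = [set c; d] -> a != b -> (a = c /\ b = d) \/ (a = d /\ b = c).
Proof.
move=> /setP E ab.
have := E a; have := E b; rewrite !inE !eqxx orbT /=.
move=> /esym/orP[]/eqP bE /esym/orP[]/eqP aE; subst; rewrite ?eqxx in ab => //.
  by right.
by left.
Qed.

(** * Ranks, and the exchange of partners between two strongly stable matchings *)

Section Stability.

Variables (V : finType) (G : instance V).
Implicit Types (M N : {set {set V}}) (S : {set V}).

Local Notation tie := (tie_index G).

(* Smaller is better; an unmatched vertex ranks below all its neighbours. *)
Definition rank M (v : V) : nat :=
  if partner M v is Some x then tie v x else size (pref G v).

(** The ties of [v] cover exactly its neighbourhood, so adjacency can be read off the preference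
    lists. *)
Lemma edgeE v u :
  ([set v; u] \in edges G) = has (fun T : {set V} => u \in T) (pref G v).
Proof.
have /and3P[/eqP/setP/(_ u) + _ _] := pref_partition G v.
rewrite inE => <-; apply/bigcupP/hasP => -[T];
  by rewrite ?inE => *; exists T; rewrite ?inE.
Qed.

Lemma tie_index_lt v u : ([set v; u] \in edges G) = (tie v u < size (pref G v)).
Proof. by rewrite edgeE has_find. Qed.

Lemma edgeC v u : ([set v; u] \in edges G) = ([set u; v] \in edges G).
Proof. by rewrite setUC. Qed.

Lemma edge_neq v u : [set v; u] \in edges G -> v != u.
Proof.
move=> /edges_bipartite[x [y [xm ym E]]]; apply: contraTneq xm => vu; subst.
have: y \in [set u; u] by rewrite E !inE eqxx orbT.
have: x \in [set u; u] by rewrite E !inE eqxx.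
by rewrite !inE => /orP[]/eqP-> /orP[]/eqP<-.
Qed.

Lemma men_side v u :
  [set v; u] \in edges G -> (v \in men G) = (u \notin men G).
Proof.
move=> e; have vu := edge_neq e; move: e => /edges_bipartite[x [y [xm ym E]]].
by case: (set2_inj E vu) => -[-> ->]; rewrite ?xm ?ym // (negbTE ym).
Qed.

Lemma partnerP M v u :
  matching G M -> (partner M v = Some u) <-> ([set v; u] \in M).
Proof.
move=> /andP[/subsetP sub /trivIsetP triv]; rewrite /partner.
split; first by case: pickP => // u' ? [<-].
move=> vuM; case: pickP => [u' vu'M|/(_ u)]; last by rewrite vuM.
have E : [set v; u] = [set v; u'].
  apply/eqP/negPn/negP => /(triv _ _ vuM vu'M)/pred0P/(_ v).
  by rewrite /= !inE eqxx.
by case: (set2_inj E (edge_neq (sub _ vuM))) => -[] => [_ ->|<- ->].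
Qed.

Lemma partner_edge M v u :
  matching G M -> partner M v = Some u -> [set v; u] \in edges G.
Proof. by move=> mM /(partnerP _ _ mM); apply/subsetP; case/andP: mM. Qed.

Lemma partner_sym M v u :
  matching G M -> partner M v = Some u -> partner M u = Some v.
Proof.
by move=> mM /(partnerP _ _ mM); rewrite setUC => /(partnerP _ _ mM).
Qed.

Lemma rank_le M v : matching G M -> rank M v <= size (pref G v).
Proof.
move=> mM; rewrite /rank; case E: partner => [u|] //.
by rewrite ltnW // -tie_index_lt (partner_edge mM E).
Qed.

(** For an edge of [M] the strict comparison is between equal numbers and fails, so the condition
    may range over all edges. The convention on ranks absorbs the cases of unmatched endpoints. *)
Lemma strongly_stableP M :
  reflect (matching G M /\ forall x y, [set x; y] \in edges G ->
            ~~ ((tie x y < rank M x) && (tie y x <= rank M y)))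
          (strongly_stable G M).
Proof.
apply: (iffP andP) => -[mM st]; split=> //.
  move=> x y e; apply: contra st => /andP[lt_x le_y].
  apply/existsP; exists [set x; y]; rewrite /blocks e /=; apply/andP; split.
    by apply: contraL lt_x => /(partnerP _ _ mM) E; rewrite /rank E ltnn.
  apply/existsP; exists x; apply/existsP; exists y; rewrite eqxx /=.
  move: lt_x le_y; rewrite /rank.
  by case: partner => [z|] lt_x; case: partner => [t|] le_y; apply/andP.
apply/existsP => -[e /and3P[eE eM /existsP[x /existsP[y]]]].
move=> /and3P[/eqP exy bx by_]; subst e.
have /negP[] := st _ _ eE; apply/andP; split; rewrite /rank.
  by case: partner bx => // _; rewrite -tie_index_lt.
by case: partner by_ => // _; rewrite ltnW // -tie_index_lt edgeC.
Qed.

(* Otherwise [x] and its [M]-partner would block [N]. *)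
Lemma rank_lt_partner M N x :
  strongly_stable G M -> strongly_stable G N -> rank M x < rank N x ->
  exists2 w, partner M x = Some w & rank N w < rank M w.
Proof.
move=> /strongly_stableP[mM stM] /strongly_stableP[mN stN] lt_x.
case E: (partner M x) => [w|]; last first.
  by have := leq_trans lt_x (rank_le x mN); rewrite /rank E ltnn.
exists w => //; have := stN _ _ (partner_edge mM E).
move: lt_x; rewrite {1}/rank E => -> /=; rewrite -ltnNge.
by rewrite /(rank M) (partner_sym mM E).
Qed.

(** By [rank_lt_partner], the [M]-partner of a vertex of the first set exists and lies in the
    second; this map is injective because partners are mutual. *)
Lemma card_rank_lt M N :
  strongly_stable G M -> strongly_stable G N ->
  #|[set x | rank M x < rank N x]| <= #|[set x | rank N x < rank M x]|.
Proof.
move=> stM stN; have /strongly_stableP[mM _] := stM.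
pose f x := odflt x (partner M x).
rewrite -(card_in_imset (f := f) (D := [set x | rank M x < rank N x])).
  apply: subset_leq_card; apply/subsetP => _ /imsetP[x + ->]; rewrite !inE.
  by move=> /(rank_lt_partner stM stN)[w E]; rewrite /f E.
move=> x y; rewrite !inE => /(rank_lt_partner stM stN)[w Ex _].
move=> /(rank_lt_partner stM stN)[w' Ey _]; rewrite /f Ex Ey /= => E; subst w'.
by have := partner_sym mM Ex; rewrite (partner_sym mM Ey) => -[].
Qed.

(* [M] injects the vertices preferring [M] into those preferring [N], and [N]
   injects them back; by counting, both injections are bijective. *)
Lemma rank_lt_other_partner M N x :
  strongly_stable G M -> strongly_stable G N -> rank M x < rank N x ->
  exists2 w, partner N x = Some w & rank N w < rank M w.
Proof.
move=> stM stN lt_x; have /strongly_stableP[mN _] := stN.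
pose f x := odflt x (partner N x).
pose P := [set x | rank M x < rank N x].
pose W := [set x | rank N x < rank M x].
have sub : f @: W \subset P.
  apply/subsetP => _ /imsetP[w + ->]; rewrite !inE.
  by move=> /(rank_lt_partner stN stM)[z E]; rewrite /f E.
have inj : {in W &, injective f}.
  move=> y z; rewrite !inE => /(rank_lt_partner stN stM)[w Ey _].
  move=> /(rank_lt_partner stN stM)[w' Ez _].
  rewrite /f Ey Ez /= => E; subst w'.
  by have := partner_sym mN Ey; rewrite (partner_sym mN Ez) => -[].
(* [f] is injective on [W] and [card_rank_lt] bounds the size of [P] by that of [W], so the
   inclusion of the image in [P] is an equality. *)
have /eqP imf : f @: W == P.
  by rewrite eqEcard sub card_in_imset // card_rank_lt.
have: x \in f @: W by rewrite imf inE.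
case/imsetP => w; rewrite inE => lt_w xE.
have [z Ew _] := rank_lt_partner stN stM lt_w.
exists w => //; move: xE; rewrite /f Ew /= => ->; exact: partner_sym.
Qed.

(** A vertex matched only in [N] would be strictly better off in [N], and [rank_lt_other_partner]
    would give it a partner in [M]. *)
Lemma same_matched M N v :
  strongly_stable G M -> strongly_stable G N ->
  partner M v = None -> partner N v = None.
Proof.
move=> stM stN EM; case EN: (partner N v) => [u|] //.
have /strongly_stableP[mN _] := stN.
have lt_v : rank N v < rank M v.
  by rewrite {2}/rank EM /rank EN -tie_index_lt (partner_edge mN EN).
by have [w] := rank_lt_other_partner stN stM lt_v; rewrite EM.
Qed.

(** * Matchings given by symmetric partner functions *)

Definition matching_of (f : V -> option V) : {set {set V}} :=
  [set e | [exists v, exists u, (f v == Some u) && (e == [set v; u])]].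

Lemma eq_matching_of f g : f =1 g -> matching_of f = matching_of g.
Proof.
move=> fg; apply/setP => e; rewrite !inE.
by apply: eq_existsb => v; rewrite fg.
Qed.

Section MatchingOf.

Variable f : V -> option V.
Hypothesis f_edge : forall v u, f v = Some u -> [set v; u] \in edges G.
Hypothesis f_sym : forall v u, f v = Some u -> f u = Some v.

Lemma mem_matching_of v u : ([set v; u] \in matching_of f) = (f v == Some u).
Proof.
rewrite inE; apply/existsP/eqP => [[a /existsP[b]]|fv]; last first.
  by exists v; apply/existsP; exists u; rewrite fv !eqxx.
move=> /andP[/eqP fab /eqP E].
have [] := set2_inj (esym E) (edge_neq (f_edge fab)); first by case=> <- <-.
by case=> <- <-; apply: f_sym.
Qed.

Lemma partner_matching_of v : partner (matching_of f) v = f v.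
Proof.
rewrite /partner; case: pickP => [u|none].
  by rewrite mem_matching_of => /eqP.
by case E: (f v) => [u|] //; have := none u; rewrite mem_matching_of E eqxx.
Qed.

Lemma matching_matching_of : matching G (matching_of f).
Proof.
apply/andP; split.
  apply/subsetP => e; rewrite inE => /existsP[v /existsP[u]].
  by move=> /andP[/eqP fv /eqP->]; apply: f_edge.
(* Any endpoint [x] of an edge determines it as [x] together with [f x], so edges that meet
   coincide. *)
have at_end A x : A \in matching_of f -> x \in A ->
    exists2 y, f x = Some y & A = [set x; y].
  rewrite inE => /existsP[v /existsP[u /andP[/eqP fv /eqP->]]].
  rewrite !inE => /orP[]/eqP->; first by exists u.
  by exists v; [apply: f_sym | rewrite setUC].
apply/trivIsetP => A B AJ BJ; apply: contraR => /pred0Pn[x /andP[xA xB]].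
have [y fx ->] := at_end _ _ AJ xA; have [z + ->] := at_end _ _ BJ xB.
by rewrite fx => -[->].
Qed.

End MatchingOf.

Lemma matching_of_partner M : matching G M -> matching_of (partner M) = M.
Proof.
move=> mM; apply/setP => e; rewrite inE.
apply/existsP/idP => [[v /existsP[u]]|eM].
  by move=> /andP[/eqP/(partnerP _ _ mM) + /eqP->].
case/andP: (mM) => /subsetP/(_ _ eM)/edges_bipartite[x [y [_ _ E]]] _.
exists x; apply/existsP; exists y; rewrite E eqxx andbT.
by apply/eqP/partnerP; rewrite -?E.
Qed.

(** Each vertex of [S] takes the better of its two partners and every other vertex the worse one.
    These choices agree along edges of [M] and of [N], and an edge blocking the result would block
    [M] or [N]. *)
Lemma join_exists S M N :
  (forall x y, [set x; y] \in edges G -> (x \in S) = (y \notin S)) ->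
  strongly_stable G M -> strongly_stable G N ->
  exists2 J, strongly_stable G J &
    {in S, forall v, rank J v = minn (rank M v) (rank N v)}.
Proof.
move=> side stM stN.
have [[mM bM] [mN bN]] := (strongly_stableP _ stM, strongly_stableP _ stN).
(* [choice v] means that [v] follows [M]; vertices with equal ranks follow [N] on both sides. *)
pose choice v :=
  if v \in S then rank M v < rank N v else rank N v < rank M v.
pose f v := if choice v then partner M v else partner N v.
(* Partners in [M] lie on different sides, and one is better off in [M] exactly when the other is
   better off in [N]. *)
have choice_M v u : partner M v = Some u -> choice v = choice u.
  move=> E; have Eu := partner_sym mM E.
  have := side _ _ (partner_edge mM E); rewrite /choice.
  case: (u \in S) => /= ->; apply/idP/idP.
  - by case/(rank_lt_other_partner stN stM) => w; rewrite E => -[->].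
  - by case/(rank_lt_partner stM stN) => w; rewrite Eu => -[->].
  - by case/(rank_lt_partner stM stN) => w; rewrite E => -[->].
  - by case/(rank_lt_other_partner stN stM) => w; rewrite Eu => -[->].
have choice_N v u : partner N v = Some u -> choice v = choice u.
  move=> E; have Eu := partner_sym mN E.
  have := side _ _ (partner_edge mN E); rewrite /choice.
  case: (u \in S) => /= ->; apply/idP/idP.
  - by case/(rank_lt_partner stN stM) => w; rewrite E => -[->].
  - by case/(rank_lt_other_partner stM stN) => w; rewrite Eu => -[->].
  - by case/(rank_lt_other_partner stM stN) => w; rewrite E => -[->].
  - by case/(rank_lt_partner stN stM) => w; rewrite Eu => -[->].
have f_edge v u : f v = Some u -> [set v; u] \in edges G.
  by rewrite /f; case: ifP => _; apply: partner_edge.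
have f_sym v u : f v = Some u -> f u = Some v.
  rewrite /f; case: ifP => cv E.
    by rewrite -(choice_M _ _ E) cv; apply: partner_sym.
  by rewrite -(choice_N _ _ E) cv; apply: partner_sym.
pose J := matching_of f.
have rankJ v : rank J v =
    if v \in S then minn (rank M v) (rank N v) else maxn (rank M v) (rank N v).
  have -> : rank J v = if choice v then rank M v else rank N v.
    by rewrite /rank partner_matching_of // /f; case: ifP.
  rewrite /choice /minn /maxn.
  by case: (v \in S); case: (ltngtP (rank M v) (rank N v)).
exists J; last by move=> v vS; rewrite rankJ vS.
apply/strongly_stableP; split; first exact: matching_matching_of.
move=> x y e; have := side _ _ e; have := bM _ _ e; have := bN _ _ e.
(* The comparison against a maximum already holds for [M] or for [N]; the one against a minimum then
   holds for that same matching, which would be blocked. *)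
rewrite !rankJ; case: (y \in S) => /= => bNe bMe ->.
  apply/negP => /andP[]; rewrite leq_max leq_min => lt_x /andP[leM leN].
  by case/orP: lt_x => lt_x; [move: bMe | move: bNe]; rewrite lt_x ?leM ?leN.
apply/negP => /andP[]; rewrite leq_max leq_min => /andP[ltM ltN].
by case/orP => le_y; [move: bMe | move: bNe]; rewrite le_y ?ltM ?ltN.
Qed.

(** Minimise the sum of the ranks over [S]: if some [N] were better for a vertex of [S], the join
    with [N] would have a smaller sum. *)
Lemma optimal_exists S M0 :
  (forall x y, [set x; y] \in edges G -> (x \in S) = (y \notin S)) ->
  strongly_stable G M0 ->
  exists2 M, strongly_stable G M &
    forall N, strongly_stable G N -> {in S, forall v, rank M v <= rank N v}.
Proof.
move=> side st0.
case: (arg_minnP (fun M => \sum_(v in S) rank M v) st0) => M stM minM.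
exists M => // N stN v vS; rewrite leqNgt; apply/negP => lt_v.
have [J stJ rankJ] := join_exists side stM stN.
have := minM _ stJ; rewrite leqNgt => /negP; apply.
rewrite (bigD1 v) //= [X in _ < X](bigD1 v) //= -addSn leq_add //.
  by rewrite rankJ // gtn_min lt_v orbT.
by apply: leq_sum => w /andP[wS _]; rewrite rankJ // geq_minl.
Qed.

Lemma women_side x y :
  [set x; y] \in edges G -> (x \in women G) = (y \notin women G).
Proof. by move=> e; rewrite !inE (men_side e). Qed.

(** If [v] outside [S] were better off in [M], its [M]-partner, which lies in [S], would be better
    off in [N]. *)
Lemma opposite_sides S M N :
  (forall x y, [set x; y] \in edges G -> (x \in S) = (y \notin S)) ->
  strongly_stable G M -> strongly_stable G N ->
  {in S, forall v, rank M v <= rank N v} ->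
  forall v, v \notin S -> rank N v <= rank M v.
Proof.
move=> side stM stN le_MN v vS; rewrite leqNgt; apply/negP => lt_v.
have /strongly_stableP[mM _] := stM.
have [w E] := rank_lt_partner stM stN lt_v; rewrite ltnNge => /negP[].
apply: le_MN; have := side _ _ (partner_edge mM E).
by rewrite (negbTE vS) => /esym/negbFE.
Qed.

(** * Domination expressed by ranks *)

Lemma at_least_as_goodE v M N : matching G M -> matching G N ->
  at_least_as_good G v M N = (rank M v <= rank N v).
Proof.
move=> mM mN; rewrite /at_least_as_good /rank /weakly_prefers.
case EM: (partner M v) => [x|]; case EN: (partner N v) => [y|] //.
  by rewrite ltnW // -tie_index_lt (partner_edge mM EM).
by apply/esym/negbTE; rewrite -ltnNge -tie_index_lt (partner_edge mN EN).
by rewrite leqnn.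
Qed.

(** Transitive on arbitrary sets of edges, as the chain lemmas require of their relation; it agrees
    with [dominates] on strongly stable matchings. *)
Definition rank_dominates M N : bool :=
  [forall v in men G, rank M v <= rank N v].

Lemma rank_dominates_trans : transitive rank_dominates.
Proof.
move=> N M L /forall_inP MN /forall_inP NL; apply/forall_inP => v vm.
exact: leq_trans (MN _ vm) (NL _ vm).
Qed.

Lemma dominatesE M N : strongly_stable G M -> strongly_stable G N ->
  dominates G M N = rank_dominates M N.
Proof.
move=> /strongly_stableP[mM _] /strongly_stableP[mN _].
by apply: eq_forallb => v; rewrite at_least_as_goodE.
Qed.

(** As [M] and [N] match the same men, a man strictly better off in [M] exists exactly when [N]
    fails to dominate [M]. *)
Lemma strictly_dominatesE M N : strongly_stable G M -> strongly_stable G N ->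
  strictly_dominates G M N = strict rank_dominates M N.
Proof.
move=> stM stN; rewrite /strictly_dominates /strict -!dominatesE //.
congr (_ && _); rewrite negb_forall_in; apply: eq_existsb => v; congr (_ && _).
rewrite /strictly_better /at_least_as_good /prefers /weakly_prefers.
case EM: (partner M v) => [x|]; case EN: (partner N v) => [y|] //.
- by rewrite ltnNge.
- by rewrite (same_matched stN stM EN) in EM.
Qed.

End Stability.

(** * Maximal chains *)

Section MaximalChain.

Variables (T : eqType) (le : rel T).
Hypothesis le_trans : transitive le.
Implicit Types s : seq T.

Local Notation lt := (strict le).

Lemma strict_irr : irreflexive lt.
Proof. by move=> x; rewrite /strict andbN. Qed.

Lemma strict_trans : transitive lt.
Proof.
move=> y x z /andP[xy yx] /andP[yz zy]; rewrite /strict (le_trans xy yz) /=.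
by apply: contra yx => zx; apply: le_trans zx.
Qed.

Lemma strict_asym x y : lt x y -> lt y x = false.
Proof. by case/andP=> xy /negbTE yx; rewrite /strict yx. Qed.

Lemma mem_insert x s : {subset s <= insert le x s}.
Proof.
move=> y ys; rewrite /insert; case: ifP => // /allP/(_ y ys) xy.
rewrite mem_cat inE !mem_filter ys !andbT orbCA orbC.
by case/orP: xy => ->; rewrite ?orbT.
Qed.

Lemma insert_sub x s : {subset insert le x s <= x :: s}.
Proof.
move=> y; rewrite /insert; case: ifP => _; last first.
  by rewrite inE => ->; rewrite orbT.
rewrite mem_cat !inE !mem_filter.
by case/or3P => [/andP[_ ->]|->|/andP[_ ->]]; rewrite ?orbT.
Qed.

Lemma maximal_chain_sub s : {subset maximal_chain le s <= s}.
Proof.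
elim: s => //= x s IHs y /insert_sub; rewrite !inE => /orP[->//|/IHs->].
by rewrite orbT.
Qed.

Lemma maximal_chain_pairwise s : pairwise lt (maximal_chain le s).
Proof.
elim: s => //= x s; move: (maximal_chain le s) => c IHc; rewrite /insert.
case: ifP => // _.
rewrite pairwise_cat /= !pairwise_filter // filter_all /= !andbT.
apply/allrelP => y z; rewrite mem_filter inE mem_filter => /andP[yx _].
by case/predU1P => [->//|/andP[xz _]]; apply: strict_trans yx xz.
Qed.

(* Chains only grow, so an element rejected at its turn still has a member of the
   chain to which it is not strictly comparable. *)
Lemma maximal_chain_maximal s x : x \in s ->
  all (fun y => lt x y || lt y x) (maximal_chain le s) ->
  x \in maximal_chain le s.
Proof.
elim: s => //= y s IHs; rewrite inE => /predU1P[->|xs] /allP cmp.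
  rewrite /insert ifT ?mem_cat ?mem_head ?orbT //.
  by apply/allP => z zc; apply/cmp/mem_insert.
by apply/mem_insert/IHs => //; apply/allP => z zc; apply/cmp/mem_insert.
Qed.

(** Otherwise [y] lies strictly before the head, hence before the whole chain; maximality makes it a
    member, which is absurd. *)
Lemma maximal_chain_head s x y c : maximal_chain le s = x :: c ->
  y \in s -> le y x -> le x y.
Proof.
move=> E ys yx; apply/idPn => xy; have lt_yx : lt y x by rewrite /strict yx xy.
have := maximal_chain_maximal ys; have := maximal_chain_pairwise s.
rewrite E /= lt_yx => /andP[/allP lt_xc _].
have -> : all (fun z => lt y z || lt z y) c.
  by apply/allP => z /lt_xc lt_xz; rewrite (strict_trans lt_yx lt_xz).
move=> /(_ isT); rewrite inE => /predU1P[yE|/lt_xc].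
  by rewrite yE strict_irr in lt_yx.
by rewrite strict_asym.
Qed.

Lemma maximal_chain_last s x y c : maximal_chain le s = rcons c x ->
  y \in s -> le x y -> le y x.
Proof.
move=> E ys xy; apply/idPn => yx; have lt_xy : lt x y by rewrite /strict xy yx.
have := maximal_chain_maximal ys; have := maximal_chain_pairwise s.
rewrite E pairwise_rcons all_rcons /= lt_xy orbT => /andP[/allP lt_cx _].
have -> : all (fun z => lt y z || lt z y) c.
  by apply/allP => z /lt_cx lt_zx; rewrite (strict_trans lt_zx lt_xy) orbT.
move=> /(_ isT); rewrite mem_rcons inE => /predU1P[yE|/lt_cx].
  by rewrite yE strict_irr in lt_xy.
by rewrite strict_asym.
Qed.

(** By transitivity, an element strictly between two neighbours is comparable to the whole chain and
    so belongs to it, but no position is possible. *)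
Lemma maximal_chain_consecutive s c1 x y c2 z :
  maximal_chain le s = c1 ++ x :: y :: c2 -> z \in s ->
  lt x z -> lt z y = false.
Proof.
move=> E zs xz; apply/negP => zy.
have := maximal_chain_maximal zs; have := maximal_chain_pairwise s.
rewrite E pairwise_cat all_cat /= xz zy orbT /=.
move=> /and3P[/allrelP lt_c1 _ /and3P[_ /allP lt_yc2 _]].
have lt_c1x w : w \in c1 -> lt w x by move=> /lt_c1; apply; rewrite mem_head.
have -> : all (fun w => lt z w || lt w z) c1.
  by apply/allP => w /lt_c1x wx; rewrite (strict_trans wx xz) orbT.
have -> : all (fun w => lt z w || lt w z) c2.
  by apply/allP => w /lt_yc2 yw; rewrite (strict_trans zy yw).
move=> /(_ isT); rewrite mem_cat !inE => /or4P[/lt_c1x|/eqP zE|/eqP zE|/lt_yc2].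
- by rewrite strict_asym.
- by rewrite zE strict_irr in xz.
- by rewrite zE strict_irr in zy.
- by rewrite strict_asym.
Qed.

End MaximalChain.

(** Transfers the chain of matchings to the chain of index lists that the program computes. *)
Lemma maximal_chain_map (S T : Type) (le : rel S) (le' : rel T) (f : S -> T) s :
  {mono f : x y / le x y >-> le' x y} ->
  maximal_chain le' (map f s) = map f (maximal_chain le s).
Proof.
move=> mono; elim: s => //= x s ->; rewrite /insert all_map.
have strictf y z : strict le' (f y) (f z) = strict le y z.
  by rewrite /strict !mono.
rewrite (eq_all (a2 := fun y => strict le x y || strict le y x)); last first.
  by move=> y /=; rewrite !strictf.
case: ifP => _ //; rewrite map_cat /= !filter_map.
by congr (map f _ ++ _ :: map f _); apply: eq_filter => y /=; rewrite strictf.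
Qed.

Lemma path_consecutive (T : Type) (r : rel T) x s :
  (forall s1 y z s2, x :: s = s1 ++ y :: z :: s2 -> r y z) -> path r x s.
Proof.
elim: s x => //= y s IHs x rP; rewrite (rP [::] x y s) //=.
by apply: IHs => s1 z t s2 E; apply: (rP (x :: s1)); rewrite E.
Qed.

Lemma maximal_sequence_chain (V : finType) (G : instance V)
    (s : seq {set {set V}}) :
  (forall M, (M \in s) = strongly_stable G M) -> s != [::] ->
  maximal_sequence G (maximal_chain (rank_dominates G) s).
Proof.
move=> mem_s; case: s mem_s => // M0 s' mem_s _.
have st0 : strongly_stable G M0 by rewrite -mem_s mem_head.
move: (M0 :: s') mem_s => s mem_s.
have stC M : M \in maximal_chain (rank_dominates G) s -> strongly_stable G M.
  by move/maximal_chain_sub; rewrite mem_s.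
case Ec: maximal_chain => [|H c].
  (* [M0] is vacuously comparable to all members of an empty chain, so it would belong to it. *)
  have := @maximal_chain_maximal _ (rank_dominates G) s M0.
  by rewrite Ec mem_s => /(_ st0 isT).
have [T stT domT] := optimal_exists (@men_side _ G) st0.
have [B stB domB] := optimal_exists (@women_side _ G) st0.
have stH : strongly_stable G H by apply: stC; rewrite Ec mem_head.
have stL : strongly_stable G (last H c) by apply: stC; rewrite Ec mem_last.
(* The man-optimal [T] dominates the head [H], and the head of a maximal chain has nothing strictly
   before it. *)
have HT : rank_dominates G H T.
  apply: maximal_chain_head Ec _ _; rewrite ?mem_s //.
  - exact: rank_dominates_trans.
  - by apply/forall_inP; apply: domT.
(* What is best for all women is worst for all men. *)
have domB' N : strongly_stable G N -> rank_dominates G N B.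
  move=> stN; apply/forall_inP => v vm.
  apply: (opposite_sides (@women_side _ G) stB stN (domB _ stN)).
  by rewrite inE negbK.
have BL : rank_dominates G B (last H c).
  apply: (maximal_chain_last (@rank_dominates_trans _ G)
    (s := s) (c := belast H c)).
  - by rewrite -lastI.
  - by rewrite mem_s.
  - exact: domB'.
apply/and4P; split.
- by apply/allP => M; rewrite -Ec; apply: stC.
- rewrite /man_optimal /optimal_for stH; apply/forall_inP => N stN.
  rewrite -[[forall _ in _, _]]/(dominates G H N) dominatesE //.
  by apply: rank_dominates_trans HT _; apply/forall_inP; apply: domT.
- rewrite /woman_optimal /optimal_for stL; apply/forall_inP => N stN.
  apply/forall_inP => v; rewrite inE => vm.
  have /strongly_stableP[mL _] := stL; have /strongly_stableP[mN _] := stN.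
  rewrite at_least_as_goodE //.
  (* Every [N] dominates [B], which dominates the last member; so the last member is worst for men,
     hence best for women. *)
  apply: (opposite_sides (@men_side _ G) stN stL) vm; apply/forall_inP.
  exact: rank_dominates_trans (domB' _ stN) BL.
apply: path_consecutive => c1 M N c2; rewrite -Ec => E.
have stM : strongly_stable G M by apply: stC; rewrite E mem_cat mem_head orbT.
have stN : strongly_stable G N by apply: stC; rewrite E mem_cat !inE eqxx !orbT.
have ltMN : strict (rank_dominates G) M N.
  have := maximal_chain_pairwise (@rank_dominates_trans _ G) s.
  by rewrite E pairwise_cat /= => /and3P[_ _ /andP[/andP[]]].
rewrite /immediately_dominates strictly_dominatesE // ltMN /=.
apply/existsP => -[L /and3P[stL']]; rewrite !strictly_dominatesE // => ML.
by rewrite (maximal_chain_consecutive (@rank_dominates_trans _ G) E) // mem_s.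
Qed.

(** * Correctness of the algorithm *)

Lemma indicesE I : indices I = iota 0 (size I).
Proof. by elim: I => //= x I ->; rewrite -[1]addn0 iotaDl. Qed.

Lemma mem_candidates I c :
  (c \in candidates I) =
  (size c == size I) && all (mem (None :: [seq Some j | j <- indices I])) c.
Proof.
rewrite /candidates; move: (None :: _) => opts.
elim: I c => [|x I IHI] [|o c] //=.
  by apply/allpairsP => -[[o c] /= []].
apply/allpairsP/and3P => [[[o' c'] /= [oo' + [-> ->]]]|[sz oo cc]].
  by rewrite IHI => /andP[].
by exists (o, c); rewrite IHI eqSS in sz *; rewrite sz cc.
Qed.

Section Encoding.

Variables (V : finType) (G : instance V).
Implicit Types M N : {set {set V}}.

Let idx (v : V) : nat := enum_rank v.

Definition instance_data : seq (bool * seq (seq nat)) :=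
  [seq (v \in men G,
        [seq [seq idx x | x <- enum (T : {set V})] | T <- pref G v])
  | v <- enum V].

Definition matching_data M : seq (option nat) :=
  [seq omap idx (partner M v) | v <- enum V].

Local Notation I := instance_data.

Lemma code_seq_map S T (f : T -> tree) (g : S -> T) (s : seq S) :
  code_seq f (map g s) = code_seq (fun x => f (g x)) s.
Proof. by elim: s => //= x s ->. Qed.

Lemma eq_code_seq T (f g : T -> tree) : f =1 g -> code_seq f =1 code_seq g.
Proof. by move=> fg; elim=> //= x s ->; rewrite fg. Qed.

Lemma code_instance_data : code I = code_instance G.
Proof.
rewrite /code /coded_seq code_seq_map; apply: eq_code_seq => v.
congr Node; rewrite /code /= code_seq_map; apply: eq_code_seq => T.
by rewrite code_seq_map.
Qed.

Lemma code_matching_data M : code (matching_data M) = code_matching M.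
Proof.
rewrite /code /coded_seq code_seq_map; apply: eq_code_seq => v.
by case: partner.
Qed.

Lemma idx_inj : injective idx.
Proof. by move=> u v /ord_inj/enum_rank_inj. Qed.

Lemma nth_enum_map T x0 (f : V -> T) v :
  nth x0 [seq f u | u <- enum V] (idx v) = f v.
Proof. by rewrite /idx (nth_map v) ?nth_enum_rank // -cardE. Qed.

Lemma size_instance_data : size I = #|V|.
Proof. by rewrite size_map -cardE. Qed.

Lemma size_matching_data M : size (matching_data M) = #|V|.
Proof. by rewrite size_map -cardE. Qed.

Lemma mem_indices i : reflect (exists v, i = idx v) (i \in indices I).
Proof.
rewrite indicesE size_instance_data mem_iota.
apply: (iffP idP) => [lt_i|[v ->]]; last exact: ltn_ord.
by exists (enum_val (Ordinal lt_i)); rewrite /idx enum_valK.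
Qed.

Lemma all_indices P : all P (indices I) = [forall v, P (idx v)].
Proof.
apply/allP/forallP => [allP v|allP i /mem_indices[v ->]] //.
by apply: allP; apply/mem_indices; exists v.
Qed.

Lemma ties_of_data v :
  ties_of I (idx v) =
  [seq [seq idx x | x <- enum (T : {set V})] | T <- pref G v].
Proof. by rewrite /ties_of nth_enum_map. Qed.

Lemma mem_tie_data u (T : {set V}) :
  has (fun k => k == idx u) [seq idx x | x <- enum T] = (u \in T).
Proof. by rewrite has_pred1 mem_map ?mem_enum //; apply: idx_inj. Qed.

Lemma tie_idx_data v u : tie_idx I (idx v) (idx u) = tie_index G v u.
Proof.
rewrite /tie_idx ties_of_data find_map; apply: eq_find => T.
exact: mem_tie_data.
Qed.

Lemma adjacent_data v u : adjacent I (idx v) (idx u) = ([set v; u] \in edges G).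
Proof.
rewrite /adjacent ties_of_data has_map edgeE; apply: eq_has => T.
exact: mem_tie_data.
Qed.

Lemma rank_idx_data M v : rank_idx I (matching_data M) (idx v) = rank G M v.
Proof.
rewrite /rank_idx /rank nth_enum_map ties_of_data size_map.
by case: partner => //= u; apply: tie_idx_data.
Qed.

Lemma dominates_idx_data M N :
  dominates_idx I (matching_data M) (matching_data N) = rank_dominates G M N.
Proof.
rewrite /dominates_idx all_indices; apply: eq_forallb => v.
by rewrite !rank_idx_data nth_enum_map.
Qed.

Lemma stable_idx_data M :
  matching G M -> stable_idx I (matching_data M) = strongly_stable G M.
Proof.
move=> mM; rewrite /stable_idx /matching_idx !all_indices.
apply/andP/strongly_stableP => [[_ /forallP st]|[_ st]]; split=> //.
- move=> x y e; have := st x; rewrite all_indices => /forallP/(_ y).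
  by rewrite adjacent_data e !tie_idx_data !rank_idx_data.
- apply/forallP => v; rewrite nth_enum_map; case E: partner => [u|] //=.
  rewrite adjacent_data (partner_edge mM E) nth_enum_map.
  by rewrite (partner_sym mM E) /= eqxx.
- apply/forallP => x; rewrite all_indices; apply/forallP => y.
  rewrite adjacent_data !tie_idx_data !rank_idx_data; apply/implyP; exact: st.
Qed.

Lemma matching_data_candidate M : matching_data M \in candidates I.
Proof.
rewrite mem_candidates size_matching_data size_instance_data eqxx all_map.
apply/allP => v _ /=.
case: partner => [u|] //=; rewrite inE /= mem_map; last by move=> ? ? [].
by apply/mem_indices; exists u.
Qed.

Definition decode (c : seq (option nat)) : {set {set V}} :=
  matching_of (fun v => [pick u | nth None c (idx v) == Some (idx u)]).

(** The tests in [matching_idx] make the partner function read off [c] symmetric and carried by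
    edges. Being a candidate fixes the length of [c] and makes each number in it the index of a
    vertex, so decoding loses nothing. *)
Lemma decodeK c : c \in candidates I -> matching_idx I c ->
  matching G (decode c) /\ matching_data (decode c) = c.
Proof.
rewrite mem_candidates size_instance_data => /andP[/eqP sz /allP opts].
rewrite /matching_idx all_indices => /forallP cP.
pose f v := [pick u | nth None c (idx v) == Some (idx u)].
have fP v u : f v = Some u -> nth None c (idx v) = Some (idx u).
  by rewrite /f; case: pickP => // w /eqP -> [->].
have f_edge v u : f v = Some u -> [set v; u] \in edges G.
  by move=> /fP E; have := cP v; rewrite E adjacent_data => /andP[].
have f_sym v u : f v = Some u -> f u = Some v.
  move=> /fP E; have := cP v; rewrite E => /andP[_]; rewrite /f.
  case: (nth None c (idx u)) => // _ /eqP ->; case: pickP => [w|/(_ v)].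
    by move=> /eqP[] /idx_inj ->.
  by rewrite eqxx.
split; first exact: matching_matching_of.
apply: (@eq_from_nth _ None) => [|i]; rewrite size_matching_data // => lt_i.
have /mem_indices[v ->] : i \in indices I.
  by rewrite indicesE mem_iota size_instance_data.
rewrite nth_enum_map (partner_matching_of f_edge f_sym) /f.
case: pickP => [u /eqP-> //|none].
have: nth None c (idx v) \in c by rewrite mem_nth // sz ltn_ord.
move/opts; rewrite /= inE => /predU1P[-> //|/mapP[j /mem_indices[u ->] E]].
by have := none u; rewrite E eqxx.
Qed.

Lemma stable_candidates : exists2 s : seq {set {set V}},
  filter (stable_idx I) (candidates I) = map matching_data s &
  forall M, (M \in s) = strongly_stable G M.
Proof.
exists (map decode (filter (stable_idx I) (candidates I))).
  rewrite -map_comp -[LHS]map_id; apply/eq_in_map => c.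
  by rewrite mem_filter => /andP[/andP[mc _] /decodeK/(_ mc)[]].
move=> M; apply/mapP/idP => [[c + ->]|stM].
  rewrite mem_filter => /andP[stc cc].
  have [mD E] := decodeK cc (proj1 (andP stc)).
  by rewrite -stable_idx_data // E.
have /strongly_stableP[mM _] := stM.
exists (matching_data M).
  by rewrite mem_filter matching_data_candidate stable_idx_data // stM.
(* Decoding the data of [M] recovers its partner function, and a matching is determined by that
   function. *)
rewrite -{1}(matching_of_partner mM); apply: eq_matching_of => v.
rewrite nth_enum_map; case: partner => [u|] /=; case: pickP => [w /eqP[]|] //.
  by move/idx_inj->.
by move/(_ u); rewrite eqxx.
Qed.

End Encoding.

Theorem theorem7 :
  exists p : prog,
    forall (V : finType) (G : instance V),
      (exists M : {set {set V}}, strongly_stable G M) ->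
      exists s : seq {set {set V}},
        maximal_sequence G s /\
        eval p (code_instance G) (code_seq (@code_matching V) s).
Proof.
have [p solveP] := computable_solve; exists p => V G [M0 stM0].
have [s Es mem_s] := stable_candidates G.
exists (maximal_chain (rank_dominates G) s); split.
  apply: maximal_sequence_chain => //.
  by apply: contraTneq stM0 => s0; rewrite -mem_s s0.
have := solveP (instance_data G).
rewrite code_instance_data /solve Es.
(* The output is the chain of index lists, which is the image of the chain of matchings under
   [matching_data]. *)
rewrite (maximal_chain_map _ (@dominates_idx_data _ G)).
rewrite /code /coded_seq code_seq_map.
by rewrite (eq_code_seq (@code_matching_data V)).
Qed.
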